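(* Let $\mathcal{K}_G$ be the Green's operator of the periodic problem on $[0,1]$ (boundary conditions $u(0)=u(1)$, $u'(0)=u'(1)$). Then $\mathcal{K}_G$ is a rank $3$ perturbation of $\mathcal{K}$, i.e. $\mathcal{T}=\mathcal{K}-\mathcal{K}_G$ has rank $3$. Moreover, $$\mathcal{T}f(x)=\sum_{k=1}^3\langle f,u_k\rangle u_k(x),$$ where $$u_1(x)=-\tfrac12+x,\qquad u_2(x)=\tfrac1{30}(10+\sqrt{30})-x+x^2,\qquad u_3(x)=\tfrac1{30}(10-\sqrt{30})-x+x^2.$$
   Context: $\langle f,g\rangle=\int_0^1f(x)g(x)\,dx$. $\mathcal{K}$ is the integral operator on $L^2(0,1)$ given by $\mathcal{K}f(x)=-\frac12\int_0^1|x-y|\,f(y)\,dy$. $A$ denotes the self-adjoint operator $-\frac{d^2}{dx^2}$ on $L^2(0,1)$ with the stated boundary conditions; it has discrete spectrum. $P$ denotes the Riesz (orthogonal) projection onto $\ker A$. The Green's operator $\mathcal{K}_G$ is the bounded operator $S$ on $L^2(0,1)$ determined by $AS=I-P$ and $SP=PS=0$; equivalently $S=\frac{1}{2\pi i}\oint z^{-1}(A-zI)^{-1}\,dz$ over a small positively oriented circle around $0$ enclosing no nonzero eigenvalue of $A$. It is an integral operator, $\mathcal{K}_Gf(x)=\int_0^1G_0(x,y)f(y)\,dy$, with $G_0$ the Green's function.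
   Formalization: The displayed expansion is false as written (for f=1, ⟨Tf,f⟩=-1/6<0 but the sum is ≥0); the formal theorem proves instead Tf=⟨f,u_1⟩u_1-(√30/4)⟨f,u_2⟩u_2+(√30/4)⟨f,u_3⟩u_3, with the same u_k and rank 3. *)

(* Defs.v *)
From HB Require Import structures.
From mathcomp Require Import all_boot all_order all_algebra.
From mathcomp Require Import all_classical all_reals all_analysis measurable_realfun.

Set Implicit Arguments.
Unset Strict Implicit.
Unset Printing Implicit Defensive.

Import Order.TTheory GRing.Theory Num.Theory.
Import numFieldNormedType.Exports.

Local Open Scope classical_set_scope.
Local Open Scope ring_scope.

(* Lebesgue measure on (0,1), extended by 0 to the real line, so that          *)
(* L^2(0,1) consists of (classes of) functions on the line which are square   *)
(* integrable for mu01; their values outside (0,1) are irrelevant.            *)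
Definition mu01 (R : realType) : {measure set (measurableTypeR R) -> \bar R} :=
  mrestr (@lebesgue_measure R) (measurable_itv `]0%R, 1%R[).

(* An element of L2 is a square-integrable function, not a class: equality in *)
(* L^2(0,1) is =L2, equality almost everywhere on (0,1).                      *)
Definition L2 (R : realType) := LfunType (mu01 R) (lee1n 2).

Definition L2eq (R : realType) (f g : L2 R) : Prop :=
  (f : R -> R) = (g : R -> R) %[ae mu01 R].

Notation "f =L2 g" := (L2eq f g) (at level 70, no associativity).

Definition inner (R : realType) (f g : L2 R) : R :=
  \int[mu01 R]_x (f x * g x).

Section ContinuousL2.
Variable R : realType.

Lemma mu01_negligible : (mu01 R).-negligible (~` `]0%R, 1%R[).
Proof.
exists (~` `]0%R, 1%R[); split => //.
- by apply: measurableC; exact: measurable_itv.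
- by rewrite /mu01 /= /mrestr setICl measure0.
Qed.

Lemma mu01_fin : mu01 R setT \is a fin_num.
Proof. by rewrite /mu01 /= /mrestr setTI lebesgue_measure_itv /= lte01 oppr0 adde0. Qed.

Lemma continuous_L2 (f : R -> R) : continuous f -> f \in Lfun (mu01 R) 2%:E.
Proof.
move=> cf.
have mf : measurable_fun setT f by exact: continuous_measurable_fun.
have [M [Mr HM]] : bounded_set (f @` `[0, 1]).
  apply: compact_bounded; apply: continuous_compact; last exact: segment_compact.
  exact: continuous_subspaceT.
rewrite inE; apply/andP; split; rewrite inE//=.
rewrite /finite_norm unlock /Lnorm poweR_lty//.
have mp : measurable_fun setT (fun x : R => (`|f x| `^ 2)%:E).
  apply/measurable_EFinP.
  apply: (measurableT_comp (measurable_powR _)) => //.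
  exact: measurableT_comp.
pose C : R := (`|M| + 1) `^ 2.
apply: (@le_lt_trans _ _ (\int[mu01 R]_x (C%:E)))%E.
  apply: ae_ge0_le_integral => //.
  - by move=> x _; rewrite poweR_ge0.
  - by move=> x _; rewrite lee_fin powR_ge0.
  - have [N [mN N0 sN]] := mu01_negligible.
    exists N; split => // x /= Hx; apply: sN => /= x01; apply: Hx => _.
    rewrite lee_fin /C ge0_ler_powR ?nnegrE ?addr_ge0//.
    apply: HM; first by rewrite (le_lt_trans (ler_norm _)) ?ltrDl.
    by exists x => //; exact: subset_itv_oo_cc.
rewrite integral_cst// lte_mul_pinfty ?lee_fin ?powR_ge0//.
by rewrite ltey_eq mu01_fin.
Qed.

Definition L2_of (f : R -> R) (cf : continuous f) : L2 R :=
  @Lfun_Sub _ (measurableTypeR R) R (mu01 R) _ (lee1n 2) f (continuous_L2 cf).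

Lemma L2_mul_integrable (f g : L2 R) :
  (mu01 R).-integrable setT (EFin \o (fun x => f x * g x)).
Proof.
by apply/Lfun1_integrable/Lfun2_mul_Lfun1; exact: LfunP.
Qed.

Lemma L2_integrable (f : L2 R) : (mu01 R).-integrable setT (EFin \o f).
Proof. exact/Lfun1_integrable/(Lfun_subset12 mu01_fin)/LfunP. Qed.

Definition Kfun (f : R -> R) (x : R) : R :=
  - 2^-1 * \int[mu01 R]_y (`|x - y| * f y).

Lemma continuous_dist (x : R) : continuous (fun y : R => `|x - y|).
Proof.
move=> y; apply: cvg_norm; apply: cvgB; [exact: cvg_cst|exact: cvg_id].
Qed.

Lemma continuous_Kfun (f : L2 R) : continuous (Kfun f).
Proof.
have If := L2_integrable f.
have Ik x : (mu01 R).-integrable setT (EFin \o (fun y => `|x - y| * f y)).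
  exact: (L2_mul_integrable (L2_of (@continuous_dist x)) f).
have INf : (mu01 R).-integrable setT (EFin \o (fun y => `|f y|)).
  exact: (integrable_norm If).
pose L := \int[mu01 R]_y `|f y|.
have L0 : 0 <= L by exact: Rintegral_ge0.
have lip x x' : `|Kfun f x - Kfun f x'| <= `|x - x'| * L.
  rewrite /Kfun -mulrBr normrM normrN.
  rewrite -RintegralB//.
  apply: (@le_trans _ _ (1 * `|x - x'| * L)); last by rewrite mul1r.
  rewrite -mulrA; apply: ler_pM => //; first by rewrite ger0_norm ?invf_le1 ?ler1n.
  have ID : (mu01 R).-integrable setT
      (EFin \o (fun y => `|x - y| * f y - `|x' - y| * f y)).
    exact: (integrableB measurableT (Ik x) (Ik x')).
  rewrite (le_trans (le_normr_Rintegral _ _))//.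
  rewrite /L -RintegralZl//; apply: le_Rintegral => //.
  - exact: (integrable_norm ID).
  - exact: (integrableZl measurableT `|x - x'| INf).
  - move=> y _; rewrite -mulrBl normrM ler_wpM2r//.
    by rewrite (le_trans (ler_dist_dist _ _))// opprB addrA subrK.
have L1 : 0 < L + 1 by rewrite ltr_wpDl.
move=> x; apply/cvgrPdist_le => e e0.
near=> z; rewrite (le_trans (lip _ _))//.
rewrite (@le_trans _ _ (`|x - z| * (L + 1)))// ?ler_wpM2l ?lerDl//.
rewrite -ler_pdivlMr//; near: z.
by apply: cvgr_dist_le; [exact: cvg_id | exact: divr_gt0].
Unshelve. all: by end_near. Qed.

End ContinuousL2.

Definition Kop (R : realType) (f : L2 R) : L2 R := L2_of (@continuous_Kfun R f).

Section Operators.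
Variable R : realType.
Implicit Types (u g f : L2 R) (S P T : L2 R -> L2 R).

(* Linearity and boundedness on classes; in particular S respects =L2. *)
Definition bounded_linear_operator S : Prop :=
  (forall (a : R) f g, S (a *: f + g) =L2 a *: S f + S g) /\
  exists M : R, forall f,
    ('N[mu01 R]_2%:E[EFin \o S f] <= M%:E * 'N[mu01 R]_2%:E[EFin \o f])%E.

(* v is in H^2(0,1), v' = w and - v'' = g: v is differentiable with           *)
(* derivative w, and w is absolutely continuous with w' = - g in L^2(0,1),    *)
(* that is, w is an indefinite integral of - g. Since w is continuous on      *)
(* [0,1], w 0 and w 1 are the one-sided derivatives of v at the endpoints.    *)
Definition neg_second_derivative (v w : R -> R) g : Prop :=
  [/\ {within `[0, 1], continuous v},
      forall x : R, 0 < x < 1 -> is_derive x 1 v (w x) &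
      forall x : R, 0 <= x <= 1 ->
        w x = w 0 - \int[@lebesgue_measure R]_(t in `[0, x]) g t].

(* Graph of A = - d^2/dx^2 with periodic boundary conditions: u is in the     *)
(* domain of A, and A u = g.                                                  *)
Definition periodic_laplacian u g : Prop :=
  exists v w : R -> R,
    [/\ (u : R -> R) = v %[ae mu01 R], neg_second_derivative v w g,
        v 0 = v 1 & w 0 = w 1].

Definition kernel_of (A : L2 R -> L2 R -> Prop) : set (L2 R) :=
  [set u | A u 0].

Definition is_orthogonal_projection (N : set (L2 R)) P : Prop :=
  forall f, N (P f) /\ forall h, N h -> inner (f - P f) h = 0.

(* A S = I - P includes that the range of S lies in the domain of A. *)
Definition is_green_operator (A : L2 R -> L2 R -> Prop) S : Prop :=
  bounded_linear_operator S /\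
  exists P, [/\ is_orthogonal_projection (kernel_of A) P,
    forall f, A (S f) (f - P f),
    forall f, S (P f) =L2 0 &
    forall f, P (S f) =L2 0].

(* For linear T: the range of T has dimension n, i.e. a basis of n elements. *)
Definition has_rank T (n : nat) : Prop :=
  exists e : 'I_n -> L2 R,
    [/\ forall c : 'I_n -> R, \sum_(i < n) c i *: e i =L2 0 ->
          forall i, c i = 0,
        forall i, exists f, T f =L2 e i &
        forall f, exists c : 'I_n -> R, T f =L2 \sum_(i < n) c i *: e i].

(* The kernel - 1/12 - (x - y)^2 / 2 of K - K_G equals                        *)
(*   u1(x) u1(y) - (sqrt 30 / 4) u2(x) u2(y) + (sqrt 30 / 4) u3(x) u3(y).     *)
(* The u_k are orthogonal but not normalized, and the form is indefinite, so  *)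
(* the weights, and the negative sign, cannot be dropped.                     *)
Definition u1_fun (x : R) : R := - 2^-1 + x.
Definition u2_fun (x : R) : R := 30^-1 * (10 + Num.sqrt 30) - x + x ^+ 2.
Definition u3_fun (x : R) : R := 30^-1 * (10 - Num.sqrt 30) - x + x ^+ 2.

Lemma continuous_u1 : continuous u1_fun.
Proof. by move=> x; apply: cvgD; [exact: cvg_cst | exact: cvg_id]. Qed.

Let continuous_quad (a : R) : continuous (fun x : R => a - x + x ^+ 2).
Proof.
move=> x; apply: cvgD; last exact: exprn_continuous.
by apply: cvgB; [exact: cvg_cst | exact: cvg_id].
Qed.

Lemma continuous_u2 : continuous u2_fun. Proof. exact: continuous_quad. Qed.
Lemma continuous_u3 : continuous u3_fun. Proof. exact: continuous_quad. Qed.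

Definition u1 : L2 R := L2_of continuous_u1.
Definition u2 : L2 R := L2_of continuous_u2.
Definition u3 : L2 R := L2_of continuous_u3.

End Operators.

(* Main.v *)
Require Import Defs.
From mathcomp Require Import all_boot all_order all_algebra.
From mathcomp Require Import all_classical all_reals all_analysis.
From mathcomp Require Import measurable_realfun ring lra.

Set Implicit Arguments.
Unset Strict Implicit.
Unset Printing Implicit Defensive.

Import Order.TTheory GRing.Theory Num.Theory.
Import numFieldNormedType.Exports.

Local Open Scope classical_set_scope.
Local Open Scope ring_scope.

(** The periodic Green's function on [0, 1] is
      G_0 (x, y) = (x - y)^2 / 2 - |x - y| / 2 + 1 / 12,
    so the term |x - y| / 2 cancels in the kernel of K - K_G and leaves the
    polynomial - 1 / 12 - (x - y)^2 / 2, which is the combination of the three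
    products u_k (x) u_k (y) with weights 1, - sqrt 30 / 4 and sqrt 30 / 4
    (uweight_sum).

    Since a Green's operator is given here through the equation A S = I - P,
    the formula is obtained by solving the boundary value problem.  Let
    c, m, s be the moments of f of order 0, 1, 2.  The kernel of A consists of
    the constants (kernel_periodicE, kernel_periodic_cst), so P f = c almost
    everywhere, and u = K_G f solves - u'' = f - c with periodic boundary
    conditions and mean 0.  On the other hand - (K f)'' = f, whence
    u = K f + (quadratic polynomial).  Periodicity determines the linear
    coefficient, the mean value determines the constant one
    (periodic_solutionE), and K f cancels in K f - K_G f (green_difference).

    The second derivative of K f exists only almost everywhere, so everything is
    done with first derivatives.  The derivative of K f is computed under the
    integral sign (is_derive_Kfun), in Caratheodory's form of differentiability:
    the difference quotient of |x - y| is a bounded function of the increment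
    which is continuous for every y different from x.  The mean of K f is
    found in the same way: K f is itself the derivative of an explicit integral
    (is_derive_signed_square, Rintegral_Kfun).

    The rank is 3 because u_1, u_2, u_3 are orthogonal and nonzero
    (inner_ubasis, unorm2_neq0): they are eigenvectors of K - K_G for nonzero
    eigenvalues, and they span its range. *)

(** * Differentiation under the integral sign *)

Lemma ae_eq_Rintegral d (T : measurableType d) (R : realType)
    (mu : {measure set T -> \bar R}) (D : set T) (f g : T -> R) :
  measurable D -> measurable_fun setT f -> measurable_fun setT g ->
  f = g %[ae mu] -> \int[mu]_(x in D) f x = \int[mu]_(x in D) g x.
Proof.
move=> mD mf mg fg; congr fine; apply: ae_eq_integral => //.
- by apply/measurable_EFinP; exact: measurable_funTS.
- by apply/measurable_EFinP; exact: measurable_funTS.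
- by apply: filterS fg => x /= + _ => /(_ I) ->.
Qed.

(** If the increments of z |-> k z y at x are s z y * (z - x), then those of the
    integral are (\int s z) * (z - x), and z |-> \int s z is continuous at x by
    dominated convergence; this is Caratheodory's criterion. Asking only that
    s be continuous for almost every y admits kernels with a corner on the
    diagonal. *)
Lemma is_derive_Rintegral d (T : measurableType d) (R : realType)
    (mu : {measure set T -> \bar R}) (k s : R -> T -> R) (g : T -> R) (x : R) :
  (forall z, mu.-integrable setT (EFin \o k z)) ->
  (forall z y, k z y - k x y = s z y * (z - x)) ->
  (forall z, measurable_fun setT (s z)) ->
  mu.-integrable setT (EFin \o g) ->
  (forall z y, `|z - x| < 1 -> `|s z y| <= g y) ->
  {ae mu, forall y, continuous (s ^~ y)} ->
  is_derive x 1 (fun z => \int[mu]_y k z y) (\int[mu]_y s x y).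
Proof.
move=> ik ks ms ig sg cs.
have is_ z : `|z - x| < 1 -> mu.-integrable setT (EFin \o s z).
  move=> zx; apply: (le_integrable measurableT _ _ ig).
    exact/measurable_EFinP.
  by move=> y _ /=; rewrite lee_fin (le_trans (sg _ _ zx))// ler_norm.
apply/is_derive1_caratheodory.
(* The domination holds near x only; farther away the slope is the plain
   difference quotient. *)
exists (fun z => if `|z - x| < 1 then \int[mu]_y s z y
                 else (\int[mu]_y k z y - \int[mu]_y k x y) / (z - x)).
split; last by rewrite /= (subrr x) normr0 ltr01.
- move=> z; case: ifPn => zx; last first.
    rewrite divfK// -normr_gt0; apply: lt_le_trans ltr01 _.
    by rewrite leNgt.
  rewrite -RintegralB// mulrC -RintegralZl//; last exact: is_.
  by apply: eq_Rintegral => y _; rewrite ks mulrC.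
- have cc : {in `]x - 1, x + 1[%classic, continuous (fun z => \int[mu]_y s z y)}.
    apply: (@continuity_under_integral _ _ _ _ _ _ measurableT _ _ _ _ g) => //.
    + move=> z /=; rewrite in_itv/= => /andP[zx1 zx2]; apply: is_.
      by rewrite ltr_norml ltrBlDr ltrBrDr addrC zx1 addrC zx2.
    + by apply: filterS cs => y cy _ z _; exact: cy.
    + move=> z /=; rewrite in_itv/= => /andP[zx1 zx2]; apply: aeW => y _; apply: sg.
      by rewrite ltr_norml ltrBlDr ltrBrDr addrC zx1 addrC zx2.
  have xI : x \in `]x - 1, x + 1[%classic.
    by rewrite inE/= in_itv/= ltrDl gtrDl oppr_lt0 ltr01.
  have := cc _ xI.
  rewrite /prop_for /continuous_at /= (subrr x) normr0 ltr01.
  apply: cvg_trans; apply: near_eq_cvg; near=> z.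
  rewrite ifT// distrC; near: z.
Unshelve. all: by end_near. Qed.

(** * The measure on the unit interval *)

(** Lets filterS and filterS2 combine statements that hold mu01-almost
    everywhere. *)
#[local] Instance ae_mu01_filter (R : realType) :
  Filter (almost_everywhere (mu01 R)).
Proof. exact: ae_filter_ringOfSetsType. Qed.

Section UnitInterval.
Variable R : realType.
Implicit Types (f F : R -> R) (A : set R).

(** The endpoints 0 and 1, which mu01 drops, form a null set. *)
Lemma mu01E A : measurable A -> A `<=` `[0, 1] ->
  mu01 R A = (@lebesgue_measure R) A.
Proof.
move=> mA A01; apply/eqP; rewrite eq_le; apply/andP; split.
  by apply: le_measure; rewrite ?inE//; exact: measurableI.
have mA' : measurable (A `&` `]0, 1[) by exact: measurableI.
have m01 : measurable ([set 0 : R] `|` [set 1]) by exact: measurableU.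
have AU : (@lebesgue_measure R A <=
    @lebesgue_measure R ((A `&` `]0%R, 1%R[) `|` ([set 0%R] `|` [set 1%R])))%E.
  apply: le_measure; rewrite ?inE//; first exact: measurableU.
  move=> x Ax; have := A01 _ Ax; rewrite /= in_itv/= => /andP[].
  rewrite le_eqVlt => /predU1P[<- _|x0]; first by right; left.
  by rewrite le_eqVlt => /predU1P[->|x1]; [right; right|left; split => //=; rewrite in_itv/= x0].
rewrite (le_trans AU)// (le_trans (measureU2 (@lebesgue_measure R) mA' m01))//.
rewrite -[leRHS]adde0 leeD// (le_trans (measureU2 (@lebesgue_measure R) _ _))//.
by apply: adde_le0; rewrite le_eqVlt; apply/orP; left; apply/eqP; exact: lebesgue_measure_set1.
Qed.

Lemma mu01_setT : mu01 R setT = 1%E.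
Proof. by rewrite /mu01 /= /mrestr setTI lebesgue_measure_itv/= lte01 oppr0 adde0. Qed.

Lemma Rintegral_mu01 f A : measurable A -> A `<=` `[0, 1] ->
  \int[mu01 R]_(x in A) f x = \int[@lebesgue_measure R]_(x in A) f x.
Proof.
move=> mA A01; congr fine; apply: eq_measure_integral => B mB BA.
by apply: mu01E => //; exact: subset_trans A01.
Qed.

Lemma mu01_ae_neq (x : R) (P : R -> Prop) :
  (forall y, 0 < y < 1 -> y <> x -> P y) -> {ae mu01 R, forall y, P y}.
Proof.
move=> H; have x0 : (mu01 R).-negligible [set x].
  exists [set x]; split => //.
  apply/eqP; rewrite eq_le measure_ge0 andbT -(lebesgue_measure_set1 x).
  by apply: le_measure; rewrite ?inE//; exact: measurableI.
apply: negligibleS (negligibleU (mu01_negligible R) x0) => y /= nP.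
apply: contrapT => /not_orP[/contrapT]; rewrite /= in_itv/= => y01 yx.
exact/nP/H.
Qed.

Lemma mu01_ae (P : R -> Prop) :
  (forall y, 0 < y < 1 -> P y) -> {ae mu01 R, forall y, P y}.
Proof. by move=> H; apply: (@mu01_ae_neq 0) => y y01 _; exact: H. Qed.

Lemma FTC_mu01 F f : (forall x : R, is_derive x 1 F (f x)) -> continuous f ->
  \int[mu01 R]_x f x = F 1 - F 0.
Proof.
move=> dF cf.
have cF : continuous F.
  move=> x; apply: differentiable_continuous; apply/derivable1_diffP.
  by have := dF x => -[].
have mf : measurable_fun setT f by exact: continuous_measurable_fun.
have m01 : measurable (`[0, 1] : set R) by exact: measurable_itv.
rewrite (@ae_eq_Rintegral _ (measurableTypeR R) R (mu01 R) _ f (f \_ `[0, 1])) //; last first.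
- apply: mu01_ae => x /andP[x0 x1]; rewrite /patch mem_set//=.
  by rewrite in_itv/= !ltW.
- apply/(measurable_restrictT _ m01); exact: measurable_funS mf.
rewrite -Rintegral_mkcond Rintegral_mu01// /Rintegral (@continuous_FTC2 _ f F)//.
- exact: continuous_subspaceT.
- split; first by move=> x _; have := dF x => -[].
    exact: cvg_at_right_filter (cF 0).
  exact: cvg_at_left_filter (cF 1).
- by move=> x _; rewrite derive1E derive_val.
Qed.

End UnitInterval.

(** * The slope of the distance function *)

Section Slope.
Variable R : realType.
Implicit Types x y z : R.

Lemma continuous_subl x : continuous (fun y : R => x - y).
Proof. by move=> y; apply: cvgB; [exact: cvg_cst|exact: cvg_id]. Qed.

Lemma continuous_quadratic (a b c : R) :
  continuous (fun x : R => a + b * x + c * x ^+ 2).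
Proof.
move=> x; apply: cvgD; last by apply: cvgM; [exact: cvg_cst|exact: exprn_continuous].
by apply: cvgD; [exact: cvg_cst|apply: cvgM; [exact: cvg_cst|exact: cvg_id]].
Qed.

(** The difference quotient of |x - y| in x, rationalized: multiplying
    |z - y| - |x - y| by |z - y| + |x - y| gives (z - x) (z + x - 2 y). In this
    form it makes sense at z = x as well, and its continuity there is that of a
    quotient. *)
Definition dist_slope x z y : R := (z + x - 2 * y) / (`|z - y| + `|x - y|).

Lemma dist_slopeE x z y : `|z - y| - `|x - y| = dist_slope x z y * (z - x).
Proof.
rewrite /dist_slope; have [d0|d0] := eqVneq (`|z - y| + `|x - y|) 0.
  move: d0 => /eqP; rewrite paddr_eq0// => /andP[/eqP -> /eqP ->].
  by rewrite addr0 invr0 mulr0 mul0r subr0.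
apply: (mulIf d0); rewrite mulrAC divfK//.
rewrite -subr_sqr !real_normK ?num_real//; ring.
Qed.

Lemma dist_slope_le1 x z y : `|dist_slope x z y| <= 1.
Proof.
rewrite /dist_slope normrM normfV [X in _ / X]ger0_norm ?addr_ge0//.
have [d0|d0] := eqVneq (`|z - y| + `|x - y|) 0.
  by rewrite d0 invr0 mulr0 ler01.
rewrite ler_pdivrMr ?lt_def ?d0 ?addr_ge0// mul1r.
have -> : z + x - 2 * y = (z - y) + (x - y) by ring.
exact: ler_normD.
Qed.

Lemma dist_slope_diag x y : dist_slope x x y = Num.sg (x - y).
Proof.
rewrite /dist_slope; have -> : x + x - 2 * y = 2 * (x - y) by ring.
rewrite -mulr2n -[`|_| *+ 2]mulr_natl invfM mulrACA divff ?pnatr_eq0// mul1r.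
case: sgrP => [->|xy|xy]; first by rewrite mul0r.
  by rewrite divff// gt_eqF.
by rewrite invrN mulrN divff// lt_eqF.
Qed.

Lemma measurable_sg : measurable_fun [set: R] (@Num.sg R).
Proof.
apply: nondecreasing_measurable => // x y xy.
by case: (sgrP x) => x0; case: (sgrP y) => y0; lra.
Qed.

(** For z different from x the slope is continuous in y, being a difference
    quotient with constant denominator z - x; for z = x it is the sign of
    x - y. *)
Lemma measurable_dist_slope x z : measurable_fun [set: R] (dist_slope x z).
Proof.
have [->|zx] := eqVneq z x.
  rewrite (_ : dist_slope x x = @Num.sg R \o (fun y => x - y)); last first.
    by apply/funext => y; rewrite dist_slope_diag.
  apply: measurableT_comp; first exact: measurable_sg.
  by apply: continuous_measurable_fun; exact: continuous_subl.
rewrite (_ : dist_slope x z = fun y => (`|z - y| - `|x - y|) / (z - x)); last first.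
  by apply/funext => y; rewrite dist_slopeE mulfK// subr_eq0.
apply: continuous_measurable_fun => y; apply: cvgM; last exact: cvg_cst.
by apply: cvgB; apply: continuous_dist.
Qed.

Lemma continuous_dist_slope x y : y <> x -> continuous (fun z => dist_slope x z y).
Proof.
move=> yx z; apply: cvgM.
  by apply: cvgB; [apply: cvgD; [exact: cvg_id|exact: cvg_cst]|exact: cvg_cst].
apply: cvgV.
  by rewrite gt_eqF// ltr_wpDl// normr_gt0 subr_eq0 eq_sym; apply/eqP.
apply: cvgD; last exact: cvg_cst.
by apply: cvg_norm; apply: cvgB; [exact: cvg_id|exact: cvg_cst].
Qed.

End Slope.

(** * Antiderivatives of K f *)

Lemma measurable_L2 (R : realType) (f : L2 R) : measurable_fun setT (f : R -> R).
Proof. by have /measurable_int/measurable_EFinP := L2_integrable f. Qed.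

Section Potential.
Variables (R : realType) (f : L2 R).
Implicit Types (x y z : R) (phi : R -> R).

Lemma integrable_contM phi : continuous phi ->
  (mu01 R).-integrable setT (EFin \o (fun y => phi y * f y)).
Proof. by move=> cphi; exact: (L2_mul_integrable (L2_of cphi) f). Qed.

Let measurable_f := measurable_L2 f.

Lemma is_derive_Kfun x :
  is_derive x (1 : R) (Kfun f) (- 2^-1 * \int[mu01 R]_y (Num.sg (x - y) * f y)).
Proof.
have -> : \int[mu01 R]_y (Num.sg (x - y) * f y) =
          \int[mu01 R]_y (dist_slope x x y * f y).
  by apply: eq_Rintegral => y _; rewrite dist_slope_diag.
apply: is_deriveZ.
apply: (@is_derive_Rintegral _ _ _ (mu01 R) (fun z y => `|z - y| * f y)
  (fun z y => dist_slope x z y * f y) (fun y => `|f y|)).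
- by move=> z; apply: integrable_contM; exact: continuous_dist.
- by move=> z y; rewrite -mulrBl dist_slopeE mulrAC.
- by move=> z; apply: measurable_funM => //; exact: measurable_dist_slope.
- exact: (integrable_norm (L2_integrable f)).
- by move=> z y _; rewrite normrM ler_piMl// dist_slope_le1.
- apply: (@mu01_ae_neq R x) => y _ yx z; apply: cvgM; last exact: cvg_cst.
  exact: continuous_dist_slope.
Qed.

(** The derivative of t |t| is 2 |t|, and - 1 / 2 |x - y| is the kernel of K. With
    s the slope of the distance, (z - y) |z - y| has at x the slope
    |z - y| + (x - y) s, bounded by 2 |x - y| + 1 as soon as |z - x| < 1. *)
Lemma is_derive_signed_square x :
  is_derive x (1 : R) (fun z => \int[mu01 R]_y ((z - y) * `|z - y| * f y))
    (- 4 * Kfun f x).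
Proof.
have -> : - 4 * Kfun f x =
    \int[mu01 R]_y ((`|x - y| + (x - y) * dist_slope x x y) * f y).
  rewrite /Kfun mulrA; have -> : - 4 * - 2^-1 = 2 :> R by field.
  rewrite -RintegralZl//; last by apply: integrable_contM; exact: continuous_dist.
  apply: eq_Rintegral => y _; rewrite dist_slope_diag.
  by rewrite [(x - y) * _]mulrC -normrEsg; ring.
apply: (@is_derive_Rintegral _ _ _ (mu01 R) (fun z y => (z - y) * `|z - y| * f y)
  (fun z y => (`|z - y| + (x - y) * dist_slope x z y) * f y)
  (fun y => `|(2 * `|x - y| + 1) * f y|)).
- move=> z; apply: integrable_contM => y; apply: cvgM; last exact: continuous_dist.
  exact: continuous_subl.
- move=> z y; have := dist_slopeE x z y; move: (dist_slope x z y) => s e.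
  have -> : `|z - y| = `|x - y| + s * (z - x) by rewrite -e; ring.
  by ring.
- move=> z; apply: measurable_funM => //; apply: measurable_funD.
    by apply: continuous_measurable_fun; exact: continuous_dist.
  apply: measurable_funM; last exact: measurable_dist_slope.
  by apply: continuous_measurable_fun; exact: continuous_subl.
- apply: integrable_norm; apply: integrable_contM => y.
  apply: cvgD; last exact: cvg_cst.
  by apply: cvgM; [exact: cvg_cst|exact: continuous_dist].
- move=> z y zx; rewrite !normrM ler_wpM2r//.
  rewrite (le_trans (ler_normD _ _))// normr_id normrM.
  rewrite [leRHS]ger0_norm ?addr_ge0 ?mulr_ge0//.
  have := ler_wpM2l (normr_ge0 (x - y)) (dist_slope_le1 x z y).
  have : `|z - y| <= `|z - x| + `|x - y|.
    by rewrite (le_trans _ (ler_normD _ _))// addrA subrK.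
  by move: zx; lra.
- apply: (@mu01_ae_neq R x) => y _ yx z; apply: cvgM; last exact: cvg_cst.
  apply: cvgD; first by apply: cvg_norm; apply: cvgB; [exact: cvg_id|exact: cvg_cst].
  by apply: cvgM; [exact: cvg_cst|exact: continuous_dist_slope].
Qed.

End Potential.

(** * Moments and the values of K f *)

Section Moments.
Variables (R : realType) (f : L2 R).
Implicit Types (x y z : R).

Definition moment (k : nat) : R := \int[mu01 R]_y (y ^+ k * f y).

Let integrable_monomial k :
  (mu01 R).-integrable setT (EFin \o (fun y => y ^+ k * f y)).
Proof. by apply: integrable_contM; exact: exprn_continuous. Qed.

Let measurable_contM (phi : R -> R) : continuous phi ->
  measurable_fun setT (fun y : R => phi y * f y).
Proof. by move=> /(integrable_contM f)/measurable_int/measurable_EFinP. Qed.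

Lemma Rintegral_quad (a b c : R) :
  \int[mu01 R]_y ((a + b * y + c * y ^+ 2) * f y) =
  a * moment 0 + b * moment 1 + c * moment 2.
Proof.
have iZ (r : R) k := integrableZl measurableT r (integrable_monomial k).
rewrite /moment -!RintegralZl//.
rewrite -RintegralD//; try exact: (iZ _ _).
rewrite -RintegralD//; try exact: (iZ _ _).
  by apply: eq_Rintegral => y _; rewrite expr0 expr1; ring.
exact: (integrableD measurableT (iZ _ _) (iZ _ _)).
Qed.

Lemma moment0E : moment 0 = \int[mu01 R]_y f y.
Proof. by apply: eq_Rintegral => y _; rewrite expr0 mul1r. Qed.

(** Distances to an endpoint of [0, 1] are polynomials inside the interval, so
    the integrals that define K f at 0 and at 1 reduce to moments. *)
Lemma Rintegral_ae_quad (phi : R -> R) (a b c : R) : continuous phi ->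
  (forall y, 0 < y < 1 -> phi y = a + b * y + c * y ^+ 2) ->
  \int[mu01 R]_y (phi y * f y) = a * moment 0 + b * moment 1 + c * moment 2.
Proof.
move=> cphi phiE; rewrite -Rintegral_quad.
apply: (@ae_eq_Rintegral _ (measurableTypeR R)) => //.
- exact: measurable_contM.
- by apply: measurable_contM; exact: continuous_quadratic.
- by apply: mu01_ae => y /phiE ->.
Qed.

Lemma Kfun0 : Kfun f 0 = - 2^-1 * moment 1.
Proof.
rewrite /Kfun (@Rintegral_ae_quad _ 0 1 0); first by ring.
  exact: continuous_dist.
by move=> y /andP[y0 _]; rewrite sub0r normrN gtr0_norm//; ring.
Qed.

Lemma Kfun1 : Kfun f 1 = - 2^-1 * (moment 0 - moment 1).
Proof.
rewrite /Kfun (@Rintegral_ae_quad _ 1 (-1) 0); first by ring.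
  exact: continuous_dist.
by move=> y /andP[_ y1]; rewrite gtr0_norm ?subr_gt0//; ring.
Qed.

(** K f is the derivative of - G / 4, where G has the kernel (x - y) |x - y|; the
    values of G at 0 and 1 are combinations of moments. *)
Lemma Rintegral_Kfun :
  \int[mu01 R]_x Kfun f x = - 4^-1 * (moment 0 - 2 * moment 1 + 2 * moment 2).
Proof.
pose G z : R := \int[mu01 R]_y ((z - y) * `|z - y| * f y).
have cG z : continuous (fun y : R => (z - y) * `|z - y|).
  move=> y; apply: cvgM; last exact: continuous_dist.
  exact: continuous_subl.
have dG x : is_derive x (1 : R) (fun z => - 4^-1 * G z) (Kfun f x).
  have := is_derive_signed_square f x.
  move=> /(is_deriveZ (- 4^-1)); rewrite /GRing.scale/=.
  rewrite mulrA; have -> : - 4^-1 * - 4 = 1 :> R by field.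
  by rewrite mul1r.
rewrite (FTC_mu01 dG); last exact: continuous_Kfun.
rewrite /G (@Rintegral_ae_quad _ 1 (-2) 1); first last.
- by move=> y /andP[_ y1]; rewrite gtr0_norm ?subr_gt0//; ring.
- exact: cG.
rewrite (@Rintegral_ae_quad _ 0 0 (-1)); first last.
- by move=> y /andP[y0 _]; rewrite sub0r normrN gtr0_norm//; ring.
- exact: cG.
by ring.
Qed.

(** Almost everywhere, sg (x - y) = 2 * 1_(y <= x) - 1; together with
    is_derive_Kfun this says that - (K f)' is, up to a constant, the indefinite
    integral of f. *)
Lemma Rintegral_sg x : 0 <= x <= 1 ->
  \int[mu01 R]_y (Num.sg (x - y) * f y) =
  2 * (\int[mu01 R]_(y in `[0, x]) f y) - moment 0.
Proof.
move=> /andP[x0 x1]; have If := L2_integrable f.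
have m0x : measurable (`[0, x] : set R) by exact: measurable_itv.
have mf := @measurable_L2 R f.
have mf0x : measurable_fun setT ((f : R -> R) \_ `[0, x]).
  by apply/(measurable_restrictT _ m0x); exact: measurable_funS mf.
have If0x : (mu01 R).-integrable setT (EFin \o ((f : R -> R) \_ `[0, x])).
  apply: (le_integrable measurableT _ _ If); first exact/measurable_EFinP.
  move=> y _ /=; rewrite lee_fin /patch; case: ifP => // _.
  by rewrite normr0.
rewrite moment0E [X in 2 * X]Rintegral_mkcond -RintegralZl// -RintegralB//; last first.
  exact: (integrableZl measurableT 2 If0x).
apply: (@ae_eq_Rintegral _ (measurableTypeR R)) => //.
- apply: measurable_funM => //; apply: measurableT_comp; first exact: measurable_sg.
  by apply: continuous_measurable_fun; exact: continuous_subl.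
- by apply: measurable_funB => //; apply: measurable_funM.
- apply: (@mu01_ae_neq R x) => y /andP[y0 y1] yx _ /=; rewrite /patch.
  have [xy|xy|xy] := ltgtP y x; last by [].
  + rewrite mem_set ?gtr0_sg ?subr_gt0//=; last by rewrite in_itv/= !ltW.
    by ring.
  + rewrite memNset ?ltr0_sg ?subr_lt0//=.
      have -> : point = 0 :> R by [].
      by ring.
    by rewrite /= in_itv/= => /andP[_]; rewrite leNgt xy.
Qed.

End Moments.

(** * The periodic boundary value problem *)

Section PeriodicProblem.
Variable R : realType.
Implicit Types (f u g : L2 R).

Lemma same_derive_increment (v q dq : R -> R) :
  {within `[0, 1], continuous v} -> continuous q ->
  (forall x : R, 0 < x < 1 -> is_derive x (1 : R) v (dq x)) ->
  (forall x : R, 0 < x < 1 -> is_derive x (1 : R) q (dq x)) ->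
  forall x, 0 <= x <= 1 -> v x - v 0 = q x - q 0.
Proof.
move=> cv cq dv_ dq_ x /andP[x0 x1].
have [y yx||y _] := @MVT_segment R (v \- q) (cst 0) 0 x x0.
- rewrite in_itv/= in yx; case/andP: yx => y0 yx.
  have y01 : 0 < y < 1 by rewrite y0 (lt_le_trans yx).
  have := dv_ _ y01; have := dq_ _ y01 => *.
  rewrite -[v \- q]/(v - q) -[cst 0 y]/(0 : R) -(subrr (dq y)).
  exact: is_deriveB.
- have cvq : {within `[0, 1], continuous (v \- q)}.
    by move=> t; apply: cvgB; [exact: cv|exact: continuous_subspaceT].
  apply: continuous_subspaceW cvq => t /=; rewrite !in_itv/= => /andP[-> tx].
  exact: le_trans tx x1.
- by rewrite /= mul0r; lra.
Qed.

(** With g = 0 the function w is constant, so v is affine, and v 0 = v 1 makes its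
    slope vanish. *)
Lemma kernel_periodicE u : periodic_laplacian u 0 ->
  exists c, (u : R -> R) = cst c %[ae mu01 R].
Proof.
move=> [v [w [uv [cv dv wE] v01 _]]]; exists (v 0).
have ww x : 0 <= x <= 1 -> w x = w 0.
  by move=> /wE ->; rewrite Rintegral_cst// mul0r subr0.
have vE : forall x, 0 <= x <= 1 -> v x - v 0 = w 0 * x - w 0 * 0.
  apply: (same_derive_increment (q := fun x => w 0 * x) (dq := cst (w 0)) cv).
  - by move=> x; apply: cvgM; [exact: cvg_cst|exact: cvg_id].
  - by move=> x x01; rewrite /= -(ww x); [exact: dv|case/andP: x01 => *; rewrite !ltW].
  - by move=> x _; apply: is_derive_eq; rewrite /GRing.scale/= mulr1.
have w0 : w 0 = 0 by have := vE 1; rewrite v01 ler01 lexx => /(_ isT); lra.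
have : {ae mu01 R, forall x, v x = v 0}.
  apply: mu01_ae => x /andP[x0 x1]; have := vE x.
  by rewrite !ltW// w0 => /(_ isT); lra.
by apply: filterS2 uv => x /= -> // ->.
Qed.

Lemma kernel_periodic_cst (c : R) (h : L2 R) :
  (h : R -> R) =1 cst c -> periodic_laplacian h 0.
Proof.
move=> hc; exists (cst c), (cst 0); split => //.
- by apply: mu01_ae => x _ _; exact: hc.
- split.
  + exact: continuous_subspaceT (@cst_continuous _ _ _).
  + by move=> x _; exact: is_derive_cst.
  + by move=> x _; rewrite /= Rintegral_cst// mul0r subr0.
Qed.

(** With c the mean of f, v' = w is an indefinite integral of c - f, and so is
    (K f + c x^2 / 2)'. Hence v = K f + a + b x + c x^2 / 2 on [0, 1]: v 0 = v 1 gives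
    b from the values of K f at 0 and 1, and the vanishing mean gives a. *)
Lemma periodic_solutionE f u g :
  periodic_laplacian u g ->
  {ae mu01 R, forall x, g x = f x - moment f 0} ->
  \int[mu01 R]_x u x = 0 ->
  {ae mu01 R, forall x, u x = Kfun f x + (moment f 0 / 12 + moment f 2 / 2
     - moment f 1 * x + moment f 0 / 2 * x ^+ 2)}.
Proof.
set c := moment f 0; set m := moment f 1; set s := moment f 2.
move=> [v [w [uv [cv dv wE] v01 _]]] gf u0.
(* K f, corrected by a polynomial so that its derivative is w. *)
pose q x := Kfun f x + (w 0 - c / 2) * x + c / 2 * x ^+ 2.
have wq x : 0 <= x <= 1 -> w x = w 0 - \int[mu01 R]_(y in `[0, x]) f y + c * x.
  move=> x01; have /andP[x0 x1] := x01.
  have sx : `[0, x] `<=` `[0, 1 : R].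
    by move=> t; rewrite /= !in_itv/= => /andP[-> tx]; exact: le_trans tx x1.
  rewrite wE// -Rintegral_mu01//.
  rewrite (@ae_eq_Rintegral _ (measurableTypeR R) R _ _ _ (fun y => f y - c))//; last first.
  - by apply: filterS gf => y + _.
  - by apply: measurable_funB; [exact: measurable_L2|exact: measurable_cst].
  rewrite RintegralB//.
  - rewrite Rintegral_cst// mu01E// lebesgue_measure_itv/= lte_fin.
    by case: ltgtP x0 => // [x0|<-] _; rewrite ?sube0/=; ring.
  - exact: integrableS (L2_integrable f).
  - by apply: integrableS (L2_integrable (L2_of (@cst_continuous _ _ c))).
have cq : continuous q.
  move=> x; apply: cvgD; last by apply: cvgM; [exact: cvg_cst|exact: exprn_continuous].
  apply: cvgD; first exact: continuous_Kfun.
  by apply: cvgM; [exact: cvg_cst|exact: cvg_id].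
have vE : forall x, 0 <= x <= 1 -> v x - v 0 = q x - q 0.
  apply: (same_derive_increment (dq := w) cv cq dv) => x /andP[x0 x1].
  have x01 : 0 <= x <= 1 by rewrite !ltW.
  have dK := is_derive_Kfun f x.
  apply: is_derive_eq; rewrite Rintegral_sg// (wq x)// -/c /GRing.scale/=.
  by field.
have w0E : w 0 = c / 2 - m.
  have := vE 1; rewrite v01 ler01 lexx => /(_ isT).
  by rewrite /q Kfun0 Kfun1 -/c -/m; lra.
pose p x := v 0 - Kfun f 0 - m * x + c / 2 * x ^+ 2.
have uE : {ae mu01 R, forall x, u x = Kfun f x + p x}.
  have : {ae mu01 R, forall x, v x = Kfun f x + p x}.
    apply: mu01_ae => x /andP[x0 x1]; have := vE x.
    by rewrite !ltW// /q /p w0E => /(_ isT); lra.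
  by apply: filterS2 uv => x /= -> // ->.
have cp : continuous p.
  rewrite (_ : p = fun x => v 0 - Kfun f 0 + - m * x + c / 2 * x ^+ 2).
    exact: continuous_quadratic.
  by apply/funext => x; rewrite /p mulNr.
have Ip : \int[mu01 R]_x p x = v 0 - Kfun f 0 - m / 2 + c / 6.
  pose P x : R := (v 0 - Kfun f 0) * x - m / 2 * x ^+ 2 + c / 6 * x ^+ 3.
  have dP (x : R) : is_derive x (1 : R) P (p x).
    by apply: is_derive_eq; rewrite /p /GRing.scale/=; field.
  by rewrite (FTC_mu01 dP cp) /P; field.
have cKf := @continuous_Kfun R f.
have : \int[mu01 R]_x (Kfun f x + p x) = 0.
  rewrite -u0; apply: (@ae_eq_Rintegral _ (measurableTypeR R)) => //.
  - apply: continuous_measurable_fun => x.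
    by apply: cvgD; [exact: cKf|exact: cp].
  - by apply: filterS uE => x -> _.
rewrite RintegralD//; last first.
- exact: L2_integrable (L2_of cp).
- exact: L2_integrable (L2_of cKf).
rewrite Rintegral_Kfun Ip -/c -/m -/s => a0.
by apply: filterS uE => x ->; rewrite /p; lra.
Qed.

End PeriodicProblem.

(** The constant 1 lies in the kernel of A, so it is orthogonal to f - P f and to
    K_G f - P (K_G f). Since P f is constant, the first relation says that it is the
    mean of f; since P (K_G f) = 0, the second says that K_G f has mean 0. *)
Lemma green_difference (R : realType) (KG : L2 R -> L2 R) (f : L2 R) :
  is_green_operator (@periodic_laplacian R) KG ->
  {ae mu01 R, forall x, (Kop f - KG f) x =
     - (moment f 0 / 12 + moment f 2 / 2 - moment f 1 * x + moment f 0 / 2 * x ^+ 2)}.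
Proof.
move=> [_ [P [projP lapl _ PKG]]].
pose one := L2_of (@cst_continuous _ _ (1 : R)).
have ker1 : kernel_of (@periodic_laplacian R) one by exact: (@kernel_periodic_cst R 1).
have inner1 (h : L2 R) : inner h one = \int[mu01 R]_x h x.
  by apply: eq_Rintegral => x _; rewrite /= mulr1.
have [kerPf orthf] := projP f.
have [c Pfc] := kernel_periodicE kerPf.
have mL2 := @measurable_L2 R.
have cE : c = moment f 0.
  have := orthf _ ker1; rewrite inner1 RintegralB//; first last.
  - exact: L2_integrable.
  - exact: L2_integrable.
  rewrite -moment0E (@ae_eq_Rintegral _ (measurableTypeR R) R _ _ (P f) (cst c))//.
  rewrite Rintegral_cst// mu01_setT mulr1 => /eqP.
  by rewrite subr_eq0 => /eqP.
have KG0 : \int[mu01 R]_x KG f x = 0.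
  have [_ orthKG] := projP (KG f).
  rewrite -(orthKG _ ker1) inner1.
  apply: (@ae_eq_Rintegral _ (measurableTypeR R)) => //.
  apply: filterS (PKG f) => x /(_ I) PK0 _.
  have {}PK0 : P (KG f) x = 0 by [].
  by rewrite -[RHS]/(KG f x - P (KG f) x) PK0 subr0.
have gf : {ae mu01 R, forall x, (f - P f) x = f x - moment f 0}.
  apply: filterS Pfc => x /(_ I) Pfx.
  by rewrite -[LHS]/(f x - P f x) -cE Pfx.
have := periodic_solutionE (lapl f) gf KG0.
apply: filterS => x KGx.
by rewrite -[LHS]/(Kfun f x - KG f x) KGx; ring.
Qed.

(** * The three functions u_k and the rank *)

Section Rank.
Variable R : realType.
Implicit Types f g h : L2 R.

Lemma inner_quad f h (a b c : R) : (forall x, h x = a + b * x + c * x ^+ 2) ->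
  inner f h = a * moment f 0 + b * moment f 1 + c * moment f 2.
Proof.
move=> hE; rewrite -Rintegral_quad.
by apply: eq_Rintegral => x _; rewrite hE mulrC.
Qed.

Lemma moment_quad h (a b c : R) k : (forall x, h x = a + b * x + c * x ^+ 2) ->
  moment h k = a / k.+1%:R + b / k.+2%:R + c / k.+3%:R.
Proof.
move=> hE.
pose p (x : R) := x ^+ k * (a + b * x + c * x ^+ 2).
pose P (x : R) := x ^+ k.+1 * (a / k.+1%:R + b / k.+2%:R * x + c / k.+3%:R * x ^+ 2).
have -> : moment h k = \int[mu01 R]_x p x.
  by apply: eq_Rintegral => x _; rewrite hE.
have dP (x : R) : is_derive x (1 : R) P (p x).
  have dX : is_derive x (1 : R) (fun y : R => y ^+ k.+1) (k.+1%:R * x ^+ k).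
    apply: DeriveDef; first exact: exprn_derivable.
    by rewrite exp_derive /GRing.scale/= mulr1.
  apply: is_derive_eq; rewrite /p /GRing.scale/=.
  have [k1 k2 k3] : [/\ k.+1%:R != 0 :> R, k.+2%:R != 0 :> R & k.+3%:R != 0 :> R].
    by rewrite !pnatr_eq0.
  have [e1 e2 e3] : [/\ k.+1%:R = k%:R + 1 :> R, k.+2%:R = k%:R + 2 :> R
      & k.+3%:R = k%:R + 3 :> R] by rewrite natr1 -!natrD addn2 addn3.
  move: k1 k2 k3; rewrite exprS e1 e2 e3 => k1 k2 k3.
  by field; rewrite k1 k2 k3.
have cp : continuous p.
  by move=> x; apply: cvgM; [exact: exprn_continuous|exact: continuous_quadratic].
by rewrite (FTC_mu01 dP cp) /P expr1n expr0n /= mul0r subr0; ring.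
Qed.

Let q : R := Num.sqrt 30.

Let q2 : q ^+ 2 = 30.
Proof. by rewrite sqr_sqrtr. Qed.

Let u1E (x : R) : u1 R x = - 2^-1 + 1 * x + 0 * x ^+ 2.
Proof. by rewrite /= /u1_fun; ring. Qed.

Let u2E (x : R) : u2 R x = 30^-1 * (10 + q) + -1 * x + 1 * x ^+ 2.
Proof. by rewrite /= /u2_fun -/q; ring. Qed.

Let u3E (x : R) : u3 R x = 30^-1 * (10 - q) + -1 * x + 1 * x ^+ 2.
Proof. by rewrite /= /u3_fun -/q; ring. Qed.

Lemma innerZ (a : R) f h : inner (a *: f) h = a * inner f h.
Proof.
rewrite /inner -RintegralZl//; last exact: L2_mul_integrable.
by apply: eq_Rintegral => x _; rewrite mulrA.
Qed.

Lemma innerD f g h : inner (f + g) h = inner f h + inner g h.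
Proof.
rewrite /inner -RintegralD//; try exact: L2_mul_integrable.
by apply: eq_Rintegral => x _; rewrite -mulrDl.
Qed.

Definition ubasis (i : 'I_3) : L2 R := nth 0 [:: u1 R; u2 R; u3 R] i.

(** The squared L^2 norms of u_1, u_2, u_3; see inner_ubasis. *)
Definition unorm2 (i : 'I_3) : R := nth 0 [:: 12^-1; 15^-1 + q / 90; 15^-1 - q / 90] i.

Lemma ord3P (Q : 'I_3 -> Prop) :
  Q ord0 -> Q (lift ord0 ord0) -> Q (lift ord0 (lift ord0 ord0)) -> forall i, Q i.
Proof.
move=> Q0 Q1 Q2 [[|[|[|//]]] lti].
- by rewrite (_ : Ordinal lti = ord0)//; exact: val_inj.
- by rewrite (_ : Ordinal lti = lift ord0 ord0)//; exact: val_inj.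
- by rewrite (_ : Ordinal lti = lift ord0 (lift ord0 ord0))//; exact: val_inj.
Qed.

Lemma inner_ubasis i j : inner (ubasis i) (ubasis j) = (i == j)%:R * unorm2 i.
Proof.
have m1 k := moment_quad k u1E; have m2 k := moment_quad k u2E.
have m3 k := moment_quad k u3E.
by elim/ord3P: i; elim/ord3P: j;
  rewrite /ubasis /unorm2 /= ?(inner_quad _ u1E) ?(inner_quad _ u2E) ?(inner_quad _ u3E)
    ?m1 ?m2 ?m3 /=; move: q2; lra.
Qed.

(** q = sqrt 30 is neither 6 nor - 6. *)
Lemma unorm2_neq0 i : unorm2 i != 0.
Proof.
elim/ord3P: i; rewrite /unorm2 /=.
- by rewrite invr_eq0 pnatr_eq0.
- apply/eqP => h; have q6 : q = - 6 by lra.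
  by move: q2; rewrite q6; lra.
- apply/eqP => h; have q6 : q = 6 by lra.
  by move: q2; rewrite q6; lra.
Qed.

(** The signature of the form: u_2 enters the kernel with a negative weight. *)
Definition uweight (i : 'I_3) : R := nth 0 [:: 1; - (q / 4); q / 4] i.

Lemma uweight_neq0 i : uweight i != 0.
Proof.
have q0 : q != 0 by apply/eqP => q0; move: q2; rewrite q0; lra.
by elim/ord3P: i; rewrite /uweight /= ?oppr_eq0 ?oner_eq0// mulf_neq0// invr_eq0 pnatr_eq0.
Qed.

(** Write u_2 = r + b and u_3 = r - b with b = q / 30 and r (x) = 1 / 3 - x + x^2, and
    let r' be r at the second point y. Then (r + b)(r' + b) - (r - b)(r' - b) =
    2 b (r + r'), and the weight q / 4 turns 2 b into q^2 / 60 = 1 / 2. *)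
Lemma uweight_sum f (x : R) :
  (\sum_(i < 3) (uweight i * inner f (ubasis i)) *: ubasis i : L2 R) x =
  - (moment f 0 / 12 + moment f 2 / 2 - moment f 1 * x + moment f 0 / 2 * x ^+ 2).
Proof.
rewrite !big_ord_recl big_ord0 addr0 /uweight /ubasis /=.
rewrite -[LHS]/(1 * inner f (u1 R) * u1 R x + (- (q / 4) * inner f (u2 R) * u2 R x
  + q / 4 * inner f (u3 R) * u3 R x)).
rewrite (inner_quad f u1E) (inner_quad f u2E) (inner_quad f u3E) u1E u2E u3E.
set c := moment f 0; set m := moment f 1; set s := moment f 2.
transitivity ((m - c / 2) * (x - 2^-1)
  - q ^+ 2 / 60 * (c / 3 - m + s + c * (3^-1 - x + x ^+ 2))); first by field.
by rewrite q2; field.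
Qed.

Lemma inner_sum_ubasis (c : 'I_3 -> R) i :
  inner (\sum_(j < 3) c j *: ubasis j) (ubasis i) = c i * unorm2 i.
Proof.
transitivity (\sum_(j < 3) c j * inner (ubasis j) (ubasis i)).
  by rewrite !big_ord_recl !big_ord0 !addr0 !innerD !innerZ.
rewrite (bigD1 i)//= big1 ?addr0 => [|j ji]; rewrite inner_ubasis.
  by rewrite eqxx mul1r.
by rewrite (negPf ji) mul0r mulr0.
Qed.

Lemma inner_ae0 f h : f =L2 0 -> inner f h = 0.
Proof.
move=> f0; rewrite /inner -[RHS](mul0r (fine (mu01 R setT))) -Rintegral_cst//.
apply: (@ae_eq_Rintegral _ (measurableTypeR R)) => //.
  by have /measurable_int/measurable_EFinP := L2_mul_integrable f h.
by apply: filterS f0 => x /(_ I) -> _; rewrite mul0r.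
Qed.

End Rank.

Theorem mainTheorem6 (R : realType) (KG : L2 R -> L2 R)
    (hKG : is_green_operator (@periodic_laplacian R) KG) :
  let T := fun f : L2 R => Kop f - KG f in
  has_rank T 3 /\
  forall f : L2 R,
    T f =L2 inner f (u1 R) *: u1 R
            - (Num.sqrt 30 / 4 * inner f (u2 R)) *: u2 R
            + (Num.sqrt 30 / 4 * inner f (u3 R)) *: u3 R.
Proof.
move=> T.
have TE f : T f =L2 \sum_(i < 3) (uweight R i * inner f (ubasis R i)) *: ubasis R i.
  apply: filterS (green_difference f hKG) => x Tx _.
  by rewrite Tx uweight_sum.
split; last first.
  move=> f; rewrite [X in _ =L2 X](_ : _ = \sum_(i < 3)
    (uweight R i * inner f (ubasis R i)) *: ubasis R i); first exact: TE.
  rewrite !big_ord_recl big_ord0 addr0 /uweight /ubasis /=.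
  by rewrite mul1r mulNr scaleNr addrA.
exists (ubasis R); split.
- move=> c c0 i.
  have : inner (\sum_(j < 3) c j *: ubasis R j) (ubasis R i) = 0.
    exact: inner_ae0.
  rewrite inner_sum_ubasis => /eqP.
  by rewrite mulf_eq0 (negPf (unorm2_neq0 _ _)) orbF => /eqP.
- move=> i; pose a := uweight R i * unorm2 R i.
  have a0 : a != 0 by rewrite mulf_neq0 ?unorm2_neq0 ?uweight_neq0.
  exists (a^-1 *: ubasis R i).
  (* u_i is an eigenvector for the eigenvalue a. *)
  rewrite [X in _ =L2 X](_ : _ = \sum_(j < 3)
    (uweight R j * inner (a^-1 *: ubasis R i) (ubasis R j)) *: ubasis R j); first exact: TE.
  rewrite (bigD1 i)//= big1 ?addr0 => [|j ji].
    by rewrite innerZ inner_ubasis eqxx mul1r mulrCA mulVf// scale1r.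
  by rewrite innerZ inner_ubasis eq_sym (negPf ji) mul0r !mulr0 scale0r.
- by move=> f; exists (fun i => uweight R i * inner f (ubasis R i)); exact: TE.
Qed.
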